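(* Consider a forward complete system $\frac{d}{dt}x(t)=f(x(t),w(t))$, $x(0)\in\mathbb{R}^n$, $w\in\mathcal{W}^m$, where $f:\mathbb{R}^n\times\mathbb{R}^m\to\mathbb{R}^n$ is locally Lipschitz in its first argument, locally uniformly in its second argument. (i) If the system has nonlinear $\mathcal{L}_2$-gain, then it is integral input-to-state stable (iISS). (ii) Conversely, if the system is iISS, then there exist changes of coordinates $S:\mathbb{R}^m\to\mathbb{R}^m$ for the input and $T:\mathbb{R}^n\to\mathbb{R}^n$ for the state such that the system in the new coordinates has nonlinear $\mathcal{L}_2$-gain; that is, there exist $\tilde\beta,\tilde\gamma\in\mathcal{K}_\infty$ such that $$\|T(x)\|_{\mathcal{L}_2[0,t]}^2\le\max\left\{\tilde\beta(|T(x(0))|),\ \tilde\gamma\left(\|S(w)\|_{\mathcal{L}_2[0,t]}^2\right)\right\}$$ for all $x(0)\in\mathbb{R}^n$, $w\in\mathcal{W}^m$, $t\in\mathbb{R}_{\ge0}$, where $T(x)$ and $S(w)$ denote the functions $\tau\mapsto T(x(\tau))$ and $\tau\mapsto S(w(\tau))$.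
   Context: $\mathcal{W}^m$ is the set of measurable, locally essentially bounded functions $w:\mathbb{R}_{\ge0}\to\mathbb{R}^m$. Forward complete means that for every initial condition and every input $w\in\mathcal{W}^m$ the solution exists for all $t\ge 0$. $\mathcal{K}_\infty$ is the class of continuous, strictly increasing, unbounded functions $\alpha:\mathbb{R}_{\ge0}\to\mathbb{R}_{\ge0}$ with $\alpha(0)=0$. $|\cdot|$ is the Euclidean norm, and $\|y\|_{\mathcal{L}_2[0,t]}^2:=\int_0^t|y(\tau)|^2d\tau$. The system is iISS if there exist $\alpha,\beta,\gamma,\sigma\in\mathcal{K}_\infty$ such that $\int_0^t\alpha(|x(\tau)|)d\tau\le\max\{\beta(|x(0)|),\gamma(\int_0^t\sigma(|w(\tau)|)d\tau)\}$ for all $x(0)\in\mathbb{R}^n$, $w\in\mathcal{W}^m$, $t\ge0$. The system has nonlinear $\mathcal{L}_2$-gain if there exist $\beta,\gamma\in\mathcal{K}_\infty$ such that $\|x\|_{\mathcal{L}_2[0,t]}^2\le\max\{\beta(|x(0)|),\gamma(\|w\|_{\mathcal{L}_2[0,t]}^2)\}$ for all $x(0)\in\mathbb{R}^n$, $w\in\mathcal{W}^m$, $t\ge0$. A change of coordinates is a homeomorphism $T:\mathbb{R}^p\to\mathbb{R}^p$ with $T(0)=0$ (differentiability is not required). *)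

(* Defs.v *)
From HB Require Import structures.
From mathcomp Require Import all_boot all_order all_algebra.
From mathcomp Require Import all_classical all_reals all_analysis.

Set Implicit Arguments.
Unset Strict Implicit.
Unset Printing Implicit Defensive.

Import Order.TTheory GRing.Theory Num.Theory.
Import numFieldNormedType.Exports.

Local Open Scope classical_set_scope.
Local Open Scope ring_scope.

(* The norm `|v| of the library on 'rV[R]_p is the sup norm. *)
Definition enorm (R : realType) (p : nat) (v : 'rV[R]_p) : R :=
  Num.sqrt (\sum_(i < p) v 0 i ^+ 2).

(* Lebesgue measure on the sigma-algebra of all Lebesgue measurable sets, not
   only the Borel ones.  Its domain type is convertible to R. *)
Notation leb R := (@completed_lebesgue_measure R).
Notation lebesgueType R :=
  (caratheodory_type (lebesgue_stieltjes_measure.wlength (@idfun R))^*%mu).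

Notation borelVectorType R p := (g_sigma_algebraType (@open 'rV[R]_p)).

(* Signals are functions on all of R of which only the restriction to
   [0, +oo[ is ever used. *)
Definition lebesgue_measurable_signal (R : realType) (p : nat)
    (w : R -> 'rV[R]_p) : Prop :=
  measurable_fun (`[0, +oo[ : set (lebesgueType R))
    (w : lebesgueType R -> borelVectorType R p).

Definition locally_ess_bounded (R : realType) (p : nat)
    (w : R -> 'rV[R]_p) : Prop :=
  forall t : R, 0 <= t ->
    exists M : R, {ae leb R, forall s : R, 0 <= s <= t -> enorm (w s) <= M}.

Definition admissible_input (R : realType) (m : nat)
    (w : R -> 'rV[R]_m) : Prop :=
  lebesgue_measurable_signal w /\ locally_ess_bounded w.

(* Functions R>=0 -> R>=0 are represented by functions R -> R; nothing is said
   about negative arguments. *)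
Definition class_Kinf (R : realType) (alpha : R -> R) : Prop :=
  [/\ {within `[0, +oo[, continuous alpha},
      {in `[0, +oo[ &, {homo alpha : r s / r < s}},
      alpha 0 = 0 &
      forall M : R, exists2 r : R, 0 <= r & M < alpha r].

Definition locally_lipschitz_fst (R : realType) (n m : nat)
    (f : 'rV[R]_n -> 'rV[R]_m -> 'rV[R]_n) : Prop :=
  forall (x0 : 'rV[R]_n) (w0 : 'rV[R]_m),
    exists L : R, exists2 U : set 'rV[R]_n, nbhs x0 U &
      exists2 V : set 'rV[R]_m, nbhs w0 V &
        forall (x y : 'rV[R]_n) (w : 'rV[R]_m), U x -> U y -> V w ->
          enorm (f x w - f y w) <= L * enorm (x - y).

(* Caratheodory solutions of x' = f(x, w) on [0, +oo[, in integral form: this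
   says that x is locally absolutely continuous and satisfies the differential
   equation almost everywhere. *)
Definition is_solution (R : realType) (n m : nat)
    (f : 'rV[R]_n -> 'rV[R]_m -> 'rV[R]_n)
    (w : R -> 'rV[R]_m) (x : R -> 'rV[R]_n) : Prop :=
  forall (t : R) (i : 'I_n), 0 <= t ->
    (leb R).-integrable `[0, t] (fun s : R => (f (x s) (w s) 0 i)%:E) /\
    x t 0 i = x 0 0 i + \int[leb R]_(s in `[0, t]) f (x s) (w s) 0 i.

Definition forward_complete (R : realType) (n m : nat)
    (f : 'rV[R]_n -> 'rV[R]_m -> 'rV[R]_n) : Prop :=
  forall (xi : 'rV[R]_n) (w : R -> 'rV[R]_m), admissible_input w ->
    exists x : R -> 'rV[R]_n, x 0 = xi /\ is_solution f w x.

(* The square of the L_2[0,t] norm.  The integral is real-valued (the value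
   +oo would be read as 0); below it is only applied to signals that are
   measurable and essentially bounded on [0,t], and so is the integral in
   [iISS], so these integrals are always finite. *)
Definition L2normsq (R : realType) (p : nat) (y : R -> 'rV[R]_p) (t : R) : R :=
  \int[leb R]_(s in `[0, t]) enorm (y s) ^+ 2.

(* Trajectories are unique under the Lipschitz assumption, so quantifying over
   the pairs (w, x) with x a solution for w amounts to quantifying over the
   initial state x(0) and the input w. *)
Definition iISS (R : realType) (n m : nat)
    (f : 'rV[R]_n -> 'rV[R]_m -> 'rV[R]_n) : Prop :=
  exists alpha beta gamma sigma : R -> R,
    [/\ class_Kinf alpha, class_Kinf beta, class_Kinf gamma & class_Kinf sigma]
    /\ forall (w : R -> 'rV[R]_m) (x : R -> 'rV[R]_n) (t : R),
      admissible_input w -> is_solution f w x -> 0 <= t ->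
      \int[leb R]_(s in `[0, t]) alpha (enorm (x s)) <=
        Num.max (beta (enorm (x 0)))
          (gamma (\int[leb R]_(s in `[0, t]) sigma (enorm (w s)))).

Definition nonlinear_L2_gain (R : realType) (n m : nat)
    (f : 'rV[R]_n -> 'rV[R]_m -> 'rV[R]_n) : Prop :=
  exists beta gamma : R -> R,
    [/\ class_Kinf beta, class_Kinf gamma &
      forall (w : R -> 'rV[R]_m) (x : R -> 'rV[R]_n) (t : R),
        admissible_input w -> is_solution f w x -> 0 <= t ->
        L2normsq x t <=
          Num.max (beta (enorm (x 0))) (gamma (L2normsq w t))].

Definition change_of_coordinates (R : realType) (p : nat)
    (T : 'rV[R]_p -> 'rV[R]_p) : Prop :=
  [/\ T 0 = 0, continuous T &
    exists T' : 'rV[R]_p -> 'rV[R]_p,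
      [/\ continuous T', cancel T T' & cancel T' T]].

(* Main.v *)
(* (i) is the special case alpha = sigma = (.)^2 of iISS.  For (ii), take the
   radial homeomorphisms T(v) = sqrt(alpha(|v|)) v / |v| and
   S(v) = sqrt(sigma(|v|)) v / |v|: then |T(x)|^2 = alpha(|x|) and
   |S(w)|^2 = sigma(|w|), so that the iISS estimate is literally the L2-gain
   estimate in the new coordinates, once beta(|x(0)|) is rewritten as
   beta(alpha^-1(|T(x(0))|^2)). *)

Require Import Defs.
From HB Require Import structures.
From mathcomp Require Import all_boot all_order all_algebra.
From mathcomp Require Import all_classical all_reals all_analysis.

Set Implicit Arguments.
Unset Strict Implicit.
Unset Printing Implicit Defensive.

Import Order.TTheory GRing.Theory Num.Theory.
Import numFieldNormedType.Exports.

Local Open Scope classical_set_scope.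
Local Open Scope ring_scope.

(** * Continuity on the closed half-line *)

Lemma continuous_max0 (R : realType) : continuous (fun r : R => Num.max 0 r).
Proof.
move=> r; apply: (@continuous_max R R (fun=> 0) id r).
- exact: cvg_cst.
- exact: cvg_id.
Qed.

(** The map [r |-> Num.max 0 r] is a continuous retraction of the line onto the half-line.
    Precomposing with it trades the subspace topology for ordinary continuity, where compositions
    and sums are easy to handle. *)
Lemma within_ge0_continuousP (R : realType) (a : R -> R) :
  {within `[0, +oo[, continuous a} <-> continuous (fun r : R => a (Num.max 0 r)).
Proof.
have maxE (r : R) : 0 <= r -> Num.max 0 r = r by move=> /max_idPr.
split=> ca.
- move=> r; move/subspace_continuousP: ca => /(_ (Num.max 0 r)).
  rewrite /= in_itv/= andbT le_max lexx => /(_ isT) car.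
  apply: (cvg_comp _ _ _ car) => U Ua.
  have maxU : \forall s \near r, `[0, +oo[%classic (Num.max 0 s) ->
    U (Num.max 0 s) by exact: (continuous_max0 Ua).
  apply: (filterS _ maxU) => s; apply.
  by rewrite /= in_itv/= andbT le_max lexx.
- apply/subspace_continuousP => r /=; rewrite in_itv/= andbT => /maxE rE.
  have := ca r; rewrite /continuous_at rE => car.
  move=> U /car; rewrite /= => aU.
  refine (@filterS _ (nbhs r) _ _ _ _ aU) => s /= + s0; rewrite maxE//.
  by move: s0; rewrite in_itv/= andbT.
Qed.

(** * Closure properties of class K-infinity *)

Section Kinf.
Variable R : realType.
Implicit Types a b : R -> R.

Lemma class_Kinf_ge0 a r : class_Kinf a -> 0 <= r -> 0 <= a r.
Proof.
move=> [_ inca a0 _]; rewrite le_eqVlt => /predU1P[<-|r0]; first by rewrite a0.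
by rewrite -a0 ltW// inca// in_itv/= andbT ?lexx// ltW.
Qed.

Lemma class_Kinf_comp a b :
  class_Kinf a -> class_Kinf b -> class_Kinf (a \o b).
Proof.
move=> Ka Kb; have b_ge0 r := @class_Kinf_ge0 b r Kb.
case: Ka => ca inca a0 ua; case: Kb => cb incb b0 ub; split.
- apply/within_ge0_continuousP => r /=.
  (* A second clamp may be inserted before [a], since [b] is nonnegative on the half-line. *)
  have -> : (fun r => a (b (Num.max 0 r))) =
      (fun r => a (Num.max 0 r)) \o (fun r => b (Num.max 0 r)).
    apply/funext => s /=; congr a; apply/esym/max_idPr.
    by rewrite b_ge0// le_max lexx.
  by apply: continuous_comp; [move: r|move: (X in {for X, _})];
    exact/within_ge0_continuousP.
- move=> r s r0 s0 rs /=; apply: inca; last exact: incb.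
  + by move: r0; rewrite !in_itv/= !andbT => /b_ge0.
  + by move: s0; rewrite !in_itv/= !andbT => /b_ge0.
- by rewrite /= b0 a0.
- move=> M; have [s s0 Ms] := ua M; have [r r0 sr] := ub s.
  exists r => //=; apply: lt_trans Ms _; apply: inca => //.
  + by rewrite in_itv/= s0.
  + by rewrite in_itv/= b_ge0.
Qed.

Lemma class_Kinf_sqr : class_Kinf (fun r : R => r ^+ 2).
Proof.
split.
- by apply: continuous_subspaceT; exact: exprn_continuous.
- move=> r s; rewrite !in_itv/= !andbT => r0 s0 rs.
  by rewrite ltr_pXn2r.
- by rewrite expr0n.
(* The witness exceeds [M] and is at least 1, hence is at most its own square. *)
- move=> M; exists (Num.max 1 (M + 1)); first by rewrite le_max ler01.
  have h1 : 1 <= Num.max 1 (M + 1) by rewrite le_max lexx.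
  have hM : M < Num.max 1 (M + 1) by rewrite lt_max ltrDl ltr01 orbT.
  by rewrite (lt_le_trans hM)// expr2 ler_peMl// (le_trans ler01).
Qed.

Lemma class_Kinf_sqrt : class_Kinf (@Num.sqrt R).
Proof.
split.
- by apply: continuous_subspaceT; exact: sqrt_continuous.
- move=> r s; rewrite !in_itv/= !andbT => r0 s0 rs.
  by rewrite ltr_sqrt// (le_lt_trans r0).
- exact: sqrtr0.
- move=> M; exists ((`|M| + 1) ^+ 2); first exact: sqr_ge0.
  rewrite sqrtr_sqr ger0_norm ?addr_ge0//.
  by rewrite (le_lt_trans (ler_norm M))// ltrDl.
Qed.

(** Passing to the whole line removes the boundary point 0: the extension is a continuous increasing
    bijection, onto by unboundedness and the intermediate value theorem, and its inverse restricts
    to the half-line. *)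
Lemma class_Kinf_inverse a : class_Kinf a ->
  exists2 b, class_Kinf b &
    (forall r, 0 <= r -> b (a r) = r) /\ (forall r, 0 <= r -> a (b r) = r).
Proof.
move=> Ka; have a_ge0 r := @class_Kinf_ge0 a r Ka; case: Ka => ca inca a0 ua.
(* [A] extends [a] by the identity to an increasing bijection of the line. *)
pose A r := a (Num.max 0 r) + Num.min 0 r.
have Aa r : 0 <= r -> A r = a r.
  by move=> r0; rewrite /A (max_idPr r0) (min_idPl r0) addr0.
have An r : r < 0 -> A r = r.
  by move=> /ltW r0; rewrite /A (max_idPl r0) (min_idPr r0) a0 add0r.
have max_ge0 (r : R) : 0 <= Num.max 0 r by rewrite le_max lexx.
have cA : continuous A.
  (* The maximum and the minimum of 0 and [r] add up to [r], so a single clamp remains. *)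
  have -> : A = (fun r => a (Num.max 0 r) + (r - Num.max 0 r)).
    apply/funext => r; rewrite /A; congr (_ + _).
    by apply/eqP; rewrite eq_sym subr_eq addrC addr_max_min add0r.
  move=> r; apply: cvgD; first by move: r; apply/within_ge0_continuousP.
  by apply: cvgB; [exact: cvg_id|exact: continuous_max0].
have Ainc : {mono A : r s / r <= s}.
  apply: le_mono => r s rs.
  have [s0|s0] := ltP s 0; first by rewrite !An// (lt_trans rs).
  have [r0|r0] := ltP r 0; first by rewrite An// Aa// (lt_le_trans r0)// a_ge0.
  by rewrite !Aa// inca// in_itv/= andbT.
have Asurj s : exists r, A r = s.
  have [s0|s0] := ltP s 0; first by exists s; rewrite An.
  have [r r0 sr] := ua s.
  have [||c _ <-] := @IVT R A 0 r s r0; last by exists c.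
  - exact: continuous_subspaceT.
  - by rewrite !Aa// a0 ge_min s0/= le_max (ltW sr) orbT.
pose B s := projT1 (cid (Asurj s)).
have BK s : A (B s) = s by rewrite /B; case: cid.
have AK r : B (A r) = r by apply: (inc_inj Ainc); rewrite BK.
have cB : continuous B.
  (* Writing [s] as [A (B s)] puts it in the image of [A], so that local continuity of [A] around
     [B s] yields continuity of its left inverse [B] at [s]. *)
  move=> s; rewrite -(BK s).
  have nearAK : {near B s, cancel A B} by apply: filterE => r; exact: AK.
  have := near_can_continuous nearAK; move=> /(_ _)/nbhs_singleton; apply.
  by apply: filterE => r; exact: cA.
have Binc : {homo B : r s / r < s} by move=> r s rs; rewrite -(leW_mono Ainc) !BK.
have B0 : B 0 = 0 by rewrite -{1}a0 -Aa// AK.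
have B_ge0 r : 0 <= r -> 0 <= B r.
  by rewrite le_eqVlt => /predU1P[<-|/Binc/ltW]; rewrite ?B0// .
exists B.
  split=> //.
  - exact: continuous_subspaceT.
  - by move=> r s _ _; exact: Binc.
  - move=> M; exists (A (Num.max 0 (M + 1))); rewrite ?AK ?Aa ?a_ge0//.
    by rewrite lt_max ltrDl ltr01 orbT.
by split=> r r0; [rewrite -Aa// AK|rewrite -Aa ?BK// B_ge0].
Qed.

End Kinf.

(** * The Euclidean norm and its relation to the sup norm *)

Section enorm.
Variables (R : realType) (p : nat).
Implicit Types v : 'rV[R]_p.

Lemma enorm_ge0 v : 0 <= enorm v.
Proof. exact: sqrtr_ge0. Qed.

Lemma enorm0 : enorm (0 : 'rV[R]_p) = 0.
Proof.
by rewrite /enorm big1 ?sqrtr0// => i _; rewrite mxE expr0n.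
Qed.

(** Each squared coordinate is one term of the sum of squares. This bound links [enorm] to the norm
    that defines the topology. *)
Lemma norm_le_enorm v : `|v| <= enorm v.
Proof.
rewrite /Num.norm/= mx_normrE; apply: bigmax_le; first exact: enorm_ge0.
move=> [i j] _ /=; rewrite ord1 -sqrtr_sqr ler_wsqrtr//.
rewrite (bigD1 j)//= lerDl; apply: sumr_ge0 => k _; exact: sqr_ge0.
Qed.

Lemma enorm_eq0 v : enorm v = 0 -> v = 0.
Proof.
by move=> v0; apply/eqP; rewrite -normr_le0 -v0 norm_le_enorm.
Qed.

Lemma enormZ k v : enorm (k *: v) = `|k| * enorm v.
Proof.
rewrite /enorm -sqrtr_sqr -sqrtrM ?sqr_ge0// mulr_sumr; congr Num.sqrt.
by apply: eq_bigr => i _; rewrite mxE exprMn.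
Qed.

Lemma continuous_enorm : continuous (@enorm R p).
Proof.
move=> v; apply: (@continuous_comp _ _ _
  (fun v : 'rV[R]_p => \sum_(i < p) v 0 i ^+ 2) Num.sqrt).
  move: v; apply: (@continuous_big _ _ +%R 0) => [|i _ v].
    by move=> x; apply: cvgD; [exact: cvg_fst|exact: cvg_snd].
  apply: (@continuous_comp _ _ _ (fun v : 'rV[R]_p => v 0 i) (fun r => r ^+ 2)).
    exact: coord_continuous.
  exact: exprn_continuous.
exact: sqrt_continuous.
Qed.

End enorm.

(* The junk value [x / 0 = 0] makes this vanish at the origin. *)
Definition radial (R : realType) (p : nat) (a : R -> R) (v : 'rV[R]_p) :=
  (a (enorm v) / enorm v) *: v.

(** * Radial maps as homeomorphisms *)

Section radial.
Variables (R : realType) (p : nat).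
Implicit Types (a b : R -> R) (v : 'rV[R]_p).

Lemma enorm_radial a v : class_Kinf a -> enorm (radial a v) = a (enorm v).
Proof.
move=> Ka; have av0 := class_Kinf_ge0 Ka (enorm_ge0 v).
rewrite enormZ ger0_norm ?divr_ge0 ?enorm_ge0//.
have [v0|v0] := eqVneq (enorm v) 0; last by rewrite divfK.
by rewrite v0 mulr0; case: Ka.
Qed.

Lemma radial0 a : radial a (0 : 'rV[R]_p) = 0.
Proof. exact: scaler0. Qed.

(** The inverse relation is demanded only at the radius [enorm v], because class K-infinity inverses
    cancel only on nonnegative arguments. Both orders of composition are instances. *)
Lemma radialK a b v : class_Kinf a -> b (a (enorm v)) = enorm v ->
  radial b (radial a v) = v.
Proof.
move=> Ka bav.
have [v0|v0] := eqVneq (enorm v) 0; first by rewrite (enorm_eq0 v0) !radial0.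
(* By strict monotonicity [a] vanishes on the half-line only at 0, so the division below is
   legitimate. *)
have av0 : a (enorm v) != 0.
  apply: contra_neq v0 => av0; have [_ inca a0 _] := Ka.
  apply/eqP; rewrite eq_le enorm_ge0 andbT leNgt; apply/negP => v_gt0.
  have := inca 0 (enorm v).
  by rewrite !in_itv/= !andbT lexx enorm_ge0 a0 av0 ltxx => /(_ isT isT v_gt0).
rewrite {1}/radial enorm_radial// bav scalerA mulrA divfK// divff//.
by rewrite scale1r.
Qed.

(** Away from the origin the scaling factor is a quotient of continuous functions with nonzero
    denominator. At the origin the quotient is useless, but the norm of the image is squeezed
    between 0 and [a (enorm u)], which tends to [a 0 = 0]. *)
Lemma continuous_radial a : class_Kinf a -> continuous (@radial R p a).
Proof.
move=> Ka v; have [ca _ a0 _] := Ka.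
have ca' : continuous (fun v : 'rV[R]_p => a (enorm v)).
  have -> : (fun v : 'rV[R]_p => a (enorm v)) =
      (fun r => a (Num.max 0 r)) \o @enorm R p.
    by apply/funext => u /=; rewrite (max_idPr _)// enorm_ge0.
  move=> u; apply: continuous_comp; first exact: continuous_enorm.
  by move: (X in {for X, _}); exact/within_ge0_continuousP.
have [v0|v0] := eqVneq (enorm v) 0; last first.
  have cn : enorm u @[u --> v] --> enorm v by exact: continuous_enorm.
  have cna : a (enorm u) @[u --> v] --> a (enorm v) by exact: ca'.
  exact: cvgZ (cvgM cna (cvgV v0 cn)) (@cvg_id _ (nbhs v)).
have /norm_cvg0P : `|radial a u| @[u --> (0 : 'rV[R]_p)] --> (0 : R^o).
  apply: (@squeeze_cvgr _ (nbhs (0 : 'rV[R]_p)) _ _ (fun=> 0)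
    (fun u => a (enorm u))).
  - apply: filterE => u; rewrite normr_ge0/= -(enorm_radial u Ka).
    exact: norm_le_enorm.
  - exact: cvg_cst.
  - by rewrite -[X in _ --> X]a0 -[X in a X](enorm0 R p); exact: ca'.
by rewrite (enorm_eq0 v0) /continuous_at radial0.
Qed.

Lemma change_of_coordinates_radial a :
  class_Kinf a -> change_of_coordinates (@radial R p a).
Proof.
move=> Ka; have [b Kb [ab ba]] := class_Kinf_inverse Ka.
split; [exact: radial0|exact: continuous_radial|].
exists (radial b); split; first exact: continuous_radial.
- by move=> v; rewrite radialK// ab// enorm_ge0.
- by move=> v; rewrite radialK// ba// enorm_ge0.
Qed.

End radial.

Theorem theorem3 (R : realType) (n m : nat)
    (f : 'rV[R]_n -> 'rV[R]_m -> 'rV[R]_n) :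
  locally_lipschitz_fst f -> forward_complete f ->
  (nonlinear_L2_gain f -> iISS f) /\
  (iISS f ->
    exists (S : 'rV[R]_m -> 'rV[R]_m) (T : 'rV[R]_n -> 'rV[R]_n),
      [/\ change_of_coordinates S, change_of_coordinates T &
        exists beta gamma : R -> R,
          [/\ class_Kinf beta, class_Kinf gamma &
            forall (w : R -> 'rV[R]_m) (x : R -> 'rV[R]_n) (t : R),
              admissible_input w -> is_solution f w x -> 0 <= t ->
              L2normsq (T \o x) t <=
                Num.max (beta (enorm (T (x 0))))
                  (gamma (L2normsq (S \o w) t))]]).
Proof.
move=> _ _; split.
- move=> [beta [gamma [Kbeta Kgamma gain]]].
  exists (fun r => r ^+ 2), beta, gamma, (fun r => r ^+ 2).
  have Ksqr := class_Kinf_sqr R.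
  (* [L2normsq] unfolds to the integral of the squared norm, so [gain] is the required estimate by
     conversion. *)
  by split; [split|exact: gain].
- move=> [alpha [beta [gamma [sigma [[Kalpha Kbeta Kgamma Ksigma] stable]]]]].
  have [b Kb [ab _]] := class_Kinf_inverse Kalpha.
  have sqrt_radial p (k : R -> R) (v : 'rV[R]_p) : class_Kinf k ->
      enorm (radial (Num.sqrt \o k) v) ^+ 2 = k (enorm v).
    move=> Kk; rewrite enorm_radial; last exact: class_Kinf_comp (class_Kinf_sqrt R) Kk.
    by rewrite sqr_sqrtr// class_Kinf_ge0// enorm_ge0.
  exists (radial (Num.sqrt \o sigma)), (radial (Num.sqrt \o alpha)).
  split; do ?[by apply: change_of_coordinates_radial; apply: class_Kinf_comp => //; exact: class_Kinf_sqrt].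
  (* Here [b] is the inverse of [alpha]. The gain [gamma] is kept, since the squared L2 norm of the
     transformed input is already the integral of [sigma (enorm (w s))]. *)
  exists (beta \o (b \o (fun r => r ^+ 2))), gamma; split=> //.
    exact: class_Kinf_comp Kbeta (class_Kinf_comp Kb (class_Kinf_sqr R)).
  have L2normsq_radial p k (y : R -> 'rV[R]_p) t : class_Kinf k ->
      L2normsq (radial (Num.sqrt \o k) \o y) t =
      \int[leb R]_(s in `[0, t]) k (enorm (y s)).
    move=> Kk; rewrite /L2normsq; congr Rintegral; apply/funext => s.
    exact: sqrt_radial.
  move=> w x t adm sol t0.
  rewrite !L2normsq_radial//= sqrt_radial// ab ?enorm_ge0//.
  exact: stable.
Qed.
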